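(* Let $n\ge 4$, $\lambda\in\mathbb{R}\setminus\{0\}$, let $a\in\mathbb{R}[x_1]$ with $\deg a=n-1$, and let $g\in\mathbb{R}[t]$ with $g(0)=0$ and $\deg g\ge 1$. Define $H=(H_1,\dots,H_n):\mathbb{R}^n\to\mathbb{R}^n$ by $$H_1=g(x_2-a(x_1)),$$ $$H_i=x_{i+1}+\frac{(-1)^i}{(i-1)!}\,a^{(i-1)}(x_1)\,g(x_2-a(x_1))^{i-1}\quad(2\le i\le n-1),$$ $$H_n=\frac{(-1)^n}{(n-1)!}\,a^{(n-1)}(x_1)\,g(x_2-a(x_1))^{n-1}.$$ Then the polynomial map $F=\lambda I+H:\mathbb{R}^n\to\mathbb{R}^n$ is bijective with polynomial inverse. Moreover, if $\lambda=1$ then $F$ is an example to the Jacobian Conjecture on $\mathbb{R}^n$, and if $\lambda<0$ then $F$ is an example to the Weak Markus--Yamabe Conjecture.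
   Context: $I$ is the identity map of $\mathbb{R}^n$, and $a^{(m)}$ is the $m$-th derivative of $a$. Jacobian Conjecture on $\mathbb{R}^n$: every polynomial map $F:\mathbb{R}^n\to\mathbb{R}^n$ with $\det JF\equiv 1$ is bijective with polynomial inverse. Weak Markus--Yamabe Conjecture: every $C^1$ Hurwitz map $F:\mathbb{R}^n\to\mathbb{R}^n$ (i.e. one such that for every $x$ all eigenvalues of $JF(x)$ have negative real part) is injective. A map is ''an example to'' one of these conjectures if it satisfies both the hypothesis and the conclusion of the conjecture: respectively, $\det JF\equiv 1$ and $F$ is bijective with polynomial inverse; or $F$ is $C^1$ Hurwitz and injective. *)

(* Defs.v *)
From HB Require Import structures.
From mathcomp Require Import all_boot all_order all_algebra.
From mathcomp Require Import all_classical all_reals all_analysis.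
From mathcomp Require Import complex.
(* Not imported: its notations clash with those of mathcomp-analysis. *)
From mathcomp Require mpoly.

Set Implicit Arguments.
Unset Strict Implicit.
Unset Printing Implicit Defensive.

Import Order.TTheory GRing.Theory Num.Theory.
Import numFieldNormedType.Exports.

Local Open Scope ring_scope.
Local Open Scope classical_set_scope.

(* Points of R^n are row vectors. *)

Definition polynomial_map (R : realType) (n : nat)
    (F : 'rV[R]_n -> 'rV[R]_n) : Prop :=
  exists P : 'I_n -> mpoly.mpoly n R,
    forall (x : 'rV[R]_n) (i : 'I_n),
      F x 0 i = mpoly.meval (fun j : 'I_n => x 0 j) (P i).

Definition bijective_with_polynomial_inverse (R : realType) (n : nat)
    (F : 'rV[R]_n -> 'rV[R]_n) : Prop :=
  exists G : 'rV[R]_n -> 'rV[R]_n,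
    [/\ polynomial_map G, cancel F G & cancel G F].

(* [jacobian] acts on row vectors on the right, so its (j, i) entry is
   dF_i/dx_j; the transpose is the usual Jacobian matrix. *)
Definition JF (R : realType) (n : nat) (F : 'rV[R]_n -> 'rV[R]_n)
    (x : 'rV[R]_n) : 'M[R]_n :=
  (jacobian F x)^T.

Definition C1_map (R : realType) (n : nat)
    (F : 'rV[R]_n -> 'rV[R]_n) : Prop :=
  (forall x : 'rV[R]_n, differentiable F x) /\
  continuous (fun x : 'rV[R]_n => JF F x).

(* Eigenvalues are taken in R[i], the complex numbers. *)
Definition Hurwitz_map (R : realType) (n : nat)
    (F : 'rV[R]_n -> 'rV[R]_n) : Prop :=
  forall (x : 'rV[R]_n) (z : R[i]),
    eigenvalue (map_mx (real_complex R) (JF F x)) z -> complex.Re z < 0.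

(* An example to a conjecture satisfies both its hypothesis and its
   conclusion. *)
Definition example_to_Jacobian_conjecture (R : realType) (n : nat)
    (F : 'rV[R]_n -> 'rV[R]_n) : Prop :=
  [/\ polynomial_map F,
      forall x : 'rV[R]_n, \det (JF F x) = 1
    & bijective_with_polynomial_inverse F].

Definition example_to_weak_Markus_Yamabe_conjecture (R : realType) (n : nat)
    (F : 'rV[R]_n -> 'rV[R]_n) : Prop :=
  [/\ C1_map F, Hurwitz_map F & injective F].

(* The coordinate x_i, numbered from 1 to n; the value is irrelevant for
   other i. *)
Definition coord1 (R : realType) (n : nat) (x : 'rV[R]_n) (i : nat) : R :=
  if insub i.-1 is Some j then x 0 j else 0.

(* H_i(x) for 1 <= i <= n. *)
Definition Hcomp (R : realType) (n : nat) (a g : {poly R})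
    (x : 'rV[R]_n) (i : nat) : R :=
  let x1 := coord1 x 1 in
  let x2 := coord1 x 2 in
  if i == 1%N then g.[x2 - a.[x1]]
  else if (i < n)%N then
    coord1 x i.+1 +
      (-1) ^+ i / (i.-1)`!%:R * a^`(i.-1).[x1] * g.[x2 - a.[x1]] ^+ i.-1
  else
    (-1) ^+ n / (n.-1)`!%:R * a^`(n.-1).[x1] * g.[x2 - a.[x1]] ^+ n.-1.

Definition Hmap (R : realType) (n : nat) (a g : {poly R})
    (x : 'rV[R]_n) : 'rV[R]_n :=
  \row_(j < n) Hcomp a g x j.+1.

(* Main.v *)
Require Import Defs.
From HB Require Import structures.
From mathcomp Require Import all_boot all_order all_algebra.
From mathcomp Require Import all_classical all_reals all_analysis.
From mathcomp Require Import complex ring zify.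
(* Only the algebraic structures on [mpoly] are imported: its notations clash
   with those of mathcomp-analysis. *)
From mathcomp Require Import(canonicals) mpoly.

Set Implicit Arguments.
Unset Strict Implicit.
Unset Printing Implicit Defensive.

Import Order.TTheory GRing.Theory Num.Theory.
Import numFieldNormedType.Exports.

Local Open Scope ring_scope.

(* With u = x_2 - a(x_1) and y = F(x), solving the equations
   y_i = lambda x_i + x_(i+1) + ... from the last one backwards gives
     sum_(k >= 2) (-1/lambda)^(k-2) y_k / lambda
       = x_2 + sum_(k >= 1) a^(k)(x_1)/k! (g(u)/lambda)^k
       = x_2 + a(x_1 + g(u)/lambda) - a(x_1) = u + a(y_1/lambda),
   by Taylor's formula, the sum being complete because deg a < n.  Hence u, then
   x_1, then all the x_i, are polynomials in y.
   The same elimination applied to the linear system (mu + JH(x)) v = 0, with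
   mu = lambda - z nonzero in a field extending R, telescopes to
   v_2 = a'(x_1) v_1 and then v = 0.  So lambda is the only complex eigenvalue
   of JF(x), which gives the Hurwitz property and det JF = lambda^n. *)

(** * Back substitution and Taylor sums *)

(** With p^(k)/k! as k-th Taylor coefficient, the factor k+1 restores (k+1)!; on coefficients this
    is a binomial identity. *)
Lemma deriv_nderivn (R : nzSemiRingType) (p : {poly R}) (k : nat) :
  p^`N(k)^`() = p^`N(k.+1) *+ k.+1.
Proof.
apply/polyP => i; rewrite coefMn coef_deriv !coef_nderivn addSnnS -!mulrnA.
by congr (_ *+ _); rewrite mulnC [RHS]mulnC -addSnnS mul_bin_left;
  congr (_ * _)%N; lia.
Qed.

(* Coefficients of the solution of [mu * v k + v k.+1 = r k] by back
   substitution, see [back_substitution]. *)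
Definition back_coef (K : fieldType) (mu : K) (k : nat) : K :=
  (- mu^-1) ^+ k / mu.

(** The sum telescopes: its terms are differences of -(-1/mu)^(k-i) v_k, whose value at n+1
    vanishes. *)
Lemma back_substitution (K : fieldType) (mu : K) (v : nat -> K) (i n : nat) :
  mu != 0 -> (i <= n.+1)%N -> v n.+1 = 0 ->
  \sum_(i <= k < n.+1) back_coef mu (k - i) * (mu * v k + v k.+1) = v i.
Proof.
move=> mu0 lein vn.
rewrite (telescope_sumr_eq (fun k => - ((- mu^-1) ^+ (k - i) * v k))) //=.
  by rewrite vn subnn; ring.
move=> k /andP[leik _]; rewrite subSn // exprS /back_coef.
by field.
Qed.

(** Converse of [back_substitution]: the sums do solve the system. The terms k > i cancel, and mu *
    [back_coef mu 0] = 1. *)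
Lemma back_substitution_step (K : fieldType) (mu : K) (r : nat -> K)
    (i n : nat) :
  mu != 0 -> (i <= n)%N ->
  mu * (\sum_(i <= k < n.+1) back_coef mu (k - i) * r k) +
  \sum_(i.+1 <= k < n.+1) back_coef mu (k - i.+1) * r k = r i.
Proof.
move=> mu0 lein; rewrite big_ltn ?ltnS //
  subnn mulrDr mulr_sumr -addrA -big_split /=.
rewrite big_nat big1 => [|k /andP[lt_ik _]]; last first.
  rewrite -(subnSK lt_ik) /back_coef exprS.
  by field.
by rewrite /back_coef; field.
Qed.

(* With [al k] = a^(k)(x_1)/k! and [ga] = g(u), this is H_i - x_(i+1). *)
Definition taylor_term (K : nzRingType) (al : nat -> K) (ga : K)
    (i : nat) : K :=
  (-1) ^+ i * al i.-1 * ga ^+ i.-1.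

(** The signs in H are chosen to cancel those of the elimination, which leaves pure powers of
    1/mu. *)
Lemma back_coef_sign (K : fieldType) (mu z : K) (k : nat) :
  mu != 0 -> back_coef mu k * ((-1) ^+ k.+2 * z) = z / mu ^+ k.+1.
Proof.
move=> mu0; rewrite /back_coef (exprNn mu^-1) exprVn.
transitivity (((-1 : K) ^+ k * (-1) ^+ k) * (z / (mu ^+ k * mu))).
  by rewrite !exprS; field; rewrite mu0 expf_neq0.
by rewrite -exprMn mulrNN mulr1 expr1n mul1r exprSr.
Qed.

(** After the shift k -> k-1 this is the Taylor expansion of a at x without its zeroth term;
    [size a <= n] makes it end at order n-1. *)
Lemma sum_taylor_term (R : fieldType) (lambda : R) (a : {poly R}) (x ga : R)
    (n : nat) :
  lambda != 0 -> (0 < n)%N -> (size a <= n)%N ->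
  \sum_(2 <= k < n.+1)
     back_coef lambda (k - 2) * taylor_term (fun k => a^`N(k).[x]) ga k =
  a.[x + ga / lambda] - a.[x].
Proof.
move=> l0 n0 san; rewrite (nderiv_taylor_wide _ san); last exact: mulrC.
rewrite -(big_mkord xpredT (fun i => a^`N(i).[x] * (ga / lambda) ^+ i))
  [in RHS]big_ltn //.
rewrite nderivn0 expr0 mulr1 addrAC subrr add0r [LHS]big_add1 /= [LHS]big_nat
  [RHS]big_nat.
apply: eq_bigr => -[//|k] _.
by rewrite /taylor_term subSS subn1 -mulrA back_coef_sign //= exprMn exprVn
  mulrA.
Qed.

(** * The linear system (mu + JH(x)) v = 0 *)

(* The i-th component of JH(x) v, with [al], [ga] as in [taylor_term] and
   [dga] = g'(u). *)
Definition diffH (K : nzRingType) (al : nat -> K) (ga dga : K) (v : nat -> K)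
    (i : nat) : K :=
  let w := v 2%N - al 1%N * v 1%N in
  if i == 1%N then dga * w
  else v i.+1 + (-1) ^+ i * ((i%:R * al i) * v 1%N * ga ^+ i.-1 +
     al i.-1 * ((i.-1)%:R * ga ^+ i.-2 * (dga * w))).

Lemma addr_diffH_injective (K : fieldType) (n : nat) (al : nat -> K)
    (ga dga mu : K) (v : nat -> K) :
  (1 < n)%N -> mu != 0 -> al n = 0 -> v n.+1 = 0 ->
  (forall i, (0 < i <= n)%N -> mu * v i + diffH al ga dga v i = 0) ->
  forall i, (0 < i <= n)%N -> v i = 0.
Proof.
move=> n1 mu0 aln vn eqv.
(* The first equation eliminates [dga] from all the others. *)
have e1 : dga * (v 2%N - al 1%N * v 1%N) = - (mu * v 1%N).
  by apply/eqP; rewrite -addr_eq0 addrC; apply/eqP/(eqv 1%N); lia.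
have eqv1 i : (1 < i < n.+1)%N -> mu * v i + v i.+1 = (-1) ^+ i *
    - ((i%:R * al i) * v 1%N * ga ^+ i.-1 - al i.-1 *
      ((i.-1)%:R * ga ^+ i.-2 * (mu * v 1%N))).
  move=> /andP[i1 lin]; have:= eqv i; rewrite /diffH e1 ifN; last by lia.
  rewrite (ltnW i1) -ltnS lin => /(_ isT) E.
  by apply/eqP; rewrite -subr_eq0 -[X in _ == X]E; apply/eqP; ring.
have v2 : v 2%N = al 1%N * v 1%N.
  rewrite -(back_substitution mu0 (leqW n1) vn).
  (* The upper boundary term contains [al n] = 0; the lower one, at k = 2, is the claimed value. *)
  rewrite (telescope_sumr_eq
    (fun k => - ((k.-1)%:R * al k.-1 * (ga / mu) ^+ k.-2 * v 1%N)));
    [|exact: leqW|].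
    by rewrite /= aln mulr0 !mul0r oppr0 sub0r opprK expr0 mulr1 mul1r.
  move=> k lk; rewrite eqv1 //; case: k lk => [|[|k]] // _.
  rewrite subSS subSS subn0 back_coef_sign //= !exprMn !exprVn.
  rewrite (exprS ga) (exprS mu).
  move: (al _) (al _) (_%:R : K) (_%:R : K) (ga ^+ k) (mu ^+ k)
    (expf_neq0 k mu0) => A B C D E F F0.
  by field; rewrite F0.
have v1 : v 1%N = 0.
  move: e1; rewrite v2 subrr mulr0 => /esym/eqP.
  by rewrite oppr_eq0 mulf_eq0 (negPf mu0) /= => /eqP.
have v0 k : (1 < k <= n)%N -> mu * v k + v k.+1 = 0.
  by move=> lk; rewrite eqv1 // v1; ring.
move=> i /andP[i0 lin]; case: i i0 lin => [//|[//|i]] _ lin.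
rewrite -(back_substitution (n := n) (i := i.+2) mu0 _ vn); last by lia.
by rewrite big_nat big1 // => k lk; rewrite v0 ?mulr0 //; lia.
Qed.

(** * Coordinates and extension of scalars *)

(* [coord1] over an arbitrary [K], since eigenvectors live over R[i]. *)
Definition rV_coord (K : nmodType) (n : nat) (x : 'rV[K]_n) (i : nat) : K :=
  if insub i.-1 is Some j then x 0 j else 0.

Lemma rV_coord_ord (K : nmodType) (n : nat) (x : 'rV[K]_n) (j : 'I_n) :
  rV_coord x j.+1 = x 0 j.
Proof. by rewrite /rV_coord valK. Qed.

(** The default value plays the role of x_(n+1) = 0, so the n-th equation has the same shape as the
    previous ones. *)
Lemma rV_coord_out (K : nmodType) (n : nat) (x : 'rV[K]_n) (i : nat) :
  (n < i)%N -> rV_coord x i = 0.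
Proof. by case: i => // i ni; rewrite /rV_coord insubF //= ltnNge -ltnS ni. Qed.

Lemma ord_of_coord (n i : nat) : (0 < i <= n)%N -> exists j : 'I_n, i = j.+1.
Proof. by case: i => // i ni; exists (Ordinal ni). Qed.

Lemma sum_rV_coord_delta (R K : nzRingType) (phi : {rmorphism R -> K}) (n : nat)
    (v : 'rV[K]_n) (i : nat) :
  \sum_j v 0 j * phi (rV_coord (delta_mx 0 j : 'rV[R]_n) i) = rV_coord v i.
Proof.
rewrite /rV_coord; case: insubP => [k _ _|_]; last first.
  by rewrite big1 // => j _; rewrite rmorph0 mulr0.
rewrite (bigD1 k) //= mxE !eqxx rmorph1 mulr1 big1 ?addr0 // => j jk.
by rewrite mxE eqxx /= eq_sym (negPf jk) rmorph0 mulr0.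
Qed.

(** By linearity of [diffH] in [v], real partial derivatives determine the action of JH(x) on
    vectors over K. *)
Lemma sum_diffH (R K : comNzRingType) (phi : {rmorphism R -> K}) (n : nat)
    (v : 'rV[K]_n) (al : nat -> R) (ga dga : R) (i : nat) :
  \sum_j v 0 j * phi (diffH al ga dga (rV_coord (delta_mx 0 j : 'rV[R]_n)) i) =
  diffH (phi \o al) (phi ga) (phi dga) (rV_coord v) i.
Proof.
rewrite /diffH -!(sum_rV_coord_delta phi v); case: ifP => _ /=.
  rewrite mulr_sumr -sumrB mulr_sumr; apply: eq_bigr => j _.
  by rewrite !(rmorphB, rmorphM) /=; ring.
rewrite !mulr_sumr !mulr_suml -sumrB !mulr_sumr -!big_split mulr_sumr
  -big_split.
apply: eq_bigr => j _.
by rewrite !(rmorphB, rmorphD, rmorphM, rmorphXn, rmorph_nat, rmorphN, rmorph1)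
  /=; ring.
Qed.

(** * Polynomial functions and their derivatives *)

(** An inductive form, so that representation by an [mpoly], differentiability and stability under
    derivation follow by induction. *)
Inductive polyfun (R : realType) (n : nat) : ('rV[R]_n -> R) -> Prop :=
| polyfun_cst c : polyfun (fun=> c)
| polyfun_coord i : polyfun (fun x => x 0 i)
| polyfunD f h of polyfun f & polyfun h : polyfun (fun x => f x + h x)
| polyfunM f h of polyfun f & polyfun h : polyfun (fun x => f x * h x).

Lemma polyfun_meval (R : realType) (n : nat) (f : 'rV[R]_n -> R) :
  polyfun f -> exists P : mpoly.mpoly n R,
    forall x, f x = mpoly.meval (fun j : 'I_n => x 0 j) P.
Proof.
elim=> [c|i|{}f h _ [P fP] _ [Q hQ]|{}f h _ [P fP] _ [Q hQ]].
- by exists (mpoly.mpolyC n c) => x; rewrite mpoly.mevalC.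
- by exists (mpoly.mpolyX R (mpoly.mnm1 i)) => x; rewrite mpoly.mevalXU.
- by exists (P + Q) => x; rewrite mpoly.mevalD fP hQ.
- by exists (P * Q) => x; rewrite mpoly.mevalM fP hQ.
Qed.

Lemma polyfun_map (R : realType) (n : nat) (F : 'rV[R]_n -> 'rV[R]_n) :
  (forall i, polyfun (fun x => F x 0 i)) -> polynomial_map F.
Proof.
move=> pF; have /choice[P FP] := fun i => polyfun_meval (pF i).
by exists P => x i; exact: FP.
Qed.

Lemma polyfun_eq (R : realType) (n : nat) (f h : 'rV[R]_n -> R) :
  polyfun f -> f =1 h -> polyfun h.
Proof. by move=> pf /funext <-. Qed.

Lemma polyfunN (R : realType) (n : nat) (f : 'rV[R]_n -> R) :
  polyfun f -> polyfun (fun x => - f x).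
Proof.
move=> pf; apply: polyfun_eq (polyfunM (polyfun_cst n (-1)) pf) _ => x.
exact: mulN1r.
Qed.

Lemma polyfunX (R : realType) (n : nat) (f : 'rV[R]_n -> R) (k : nat) :
  polyfun f -> polyfun (fun x => f x ^+ k).
Proof.
move=> pf; elim: k => [|k IH]; first exact: polyfun_cst.
by apply: polyfun_eq (polyfunM pf IH) _ => x; rewrite exprS.
Qed.

Lemma polyfun_horner (R : realType) (n : nat) (p : {poly R}) (f : 'rV[R]_n -> R)
    :
  polyfun f -> polyfun (fun x => p.[f x]).
Proof.
move=> pf; elim/poly_ind: p => [|p c IH].
  by apply: polyfun_eq (polyfun_cst n 0) _ => x; rewrite horner0.
apply: polyfun_eq (polyfunD (polyfunM IH pf) (polyfun_cst n c)) _ => x.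
by rewrite hornerMXaddC.
Qed.

Lemma polyfun_sum (R : realType) (n : nat) (r : seq nat)
    (f : nat -> 'rV[R]_n -> R) :
  (forall k, polyfun (f k)) -> polyfun (fun x => \sum_(k <- r) f k x).
Proof.
move=> pf; elim: r => [|k r IH].
  by apply: polyfun_eq (polyfun_cst n 0) _ => x; rewrite big_nil.
by apply: polyfun_eq (polyfunD (pf k) IH) _ => x; rewrite big_cons.
Qed.

Lemma polyfun_coord1 (R : realType) (n : nat) (i : nat) :
  polyfun (fun x : 'rV[R]_n => coord1 x i).
Proof.
by rewrite /coord1; case: insubP => [j _ _|_];
  [exact: polyfun_coord|exact: polyfun_cst].
Qed.

Lemma polyfun_differentiable (R : realType) (n : nat) (f : 'rV[R]_n -> R)
    (x : 'rV[R]_n) : polyfun f -> differentiable f x.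
Proof.
elim=> [c|i|{}f h _ df _ dh|{}f h _ df _ dh].
- exact: differentiable_cst.
- exact: differentiable_coord.
- exact: differentiableD.
- exact: differentiableM.
Qed.

Lemma derive_coord (R : realType) (n : nat) (x v : 'rV[R]_n) (i : 'I_n) :
  'D_v (fun y : 'rV[R]_n => y 0 i) x = v 0 i.
Proof.
have := derive_mx (@derivable_id _ _ x v).
by rewrite derive_id => /matrixP/(_ 0 i); rewrite mxE.
Qed.

(** Gives the C^1 property: partial derivatives, being polynomial, are continuous. *)
Lemma polyfun_derive (R : realType) (n : nat) (f : 'rV[R]_n -> R)
    (v : 'rV[R]_n) : polyfun f -> polyfun (fun x => 'D_v f x).
Proof.
have drv h x : polyfun h -> derivable h x v.
  by move=> ph; exact/diff_derivable/polyfun_differentiable.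
elim=> [c|i|{}f h pf df ph dh|{}f h pf df ph dh].
- by apply: polyfun_eq (polyfun_cst n 0) _ => x; rewrite derive_cst.
- apply: polyfun_eq (polyfun_cst n (v 0 i)) _ => x.
  by rewrite derive_coord.
- apply: polyfun_eq (polyfunD df dh) _ => x.
  by rewrite deriveD //; exact: drv.
- apply: polyfun_eq (polyfunD (polyfunM pf dh) (polyfunM ph df)) _ => x.
  by rewrite deriveM //; exact: drv.
Qed.

Lemma is_derive_coord1 (R : realType) (n : nat) (x v : 'rV[R]_n) (i : nat) :
  is_derive x v (fun y : 'rV[R]_n => coord1 y i) (coord1 v i).
Proof.
apply: DeriveDef;
  first exact/diff_derivable/polyfun_differentiable/polyfun_coord1.
rewrite /coord1; case: insubP => [j _ _|_]; first exact: derive_coord.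
exact: derive_cst.
Qed.

Lemma is_derive_horner_comp (R : realType) (V : normedModType R) (p : {poly R})
    (f : V -> R) (x v : V) (df : R) :
  is_derive x v f df ->
  is_derive x v (fun y => p.[f y]) (p^`().[f x] * df).
Proof.
move=> dfx; elim/poly_ind: p => [|p c IH].
  rewrite (_ : (fun y => _) = cst 0); last by apply/funext => y;
    rewrite horner0.
  by rewrite deriv0 horner0 mul0r; exact: is_derive_cst.
rewrite (_ : (fun y => _) = (fun y => p.[f y]) * f + cst c).
  apply: is_derive_eq; rewrite derivMXaddC !hornerE /GRing.scale /=; ring.
by apply/funext => y; rewrite hornerMXaddC.
Qed.

(** A matrix is the finite sum of its entries times constant matrices, which reduces the claim to
    scalar functions. *)
Lemma differentiable_mx (R : realType) (V : normedModType R) (m n : nat)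
    (M : V -> 'M[R]_(m, n)) (x : V) :
  (forall i j, differentiable (fun y => M y i j) x) -> differentiable M x.
Proof.
move=> dM.
have -> : M = \sum_i \sum_j (fun y => M y i j *: delta_mx i j).
  apply/funext => y; rewrite fct_sumE [LHS]matrix_sum_delta.
  by apply: eq_bigr => i _; rewrite fct_sumE.
apply: differentiable_sum => i; apply: differentiable_sum => j.
exact: differentiableZl.
Qed.

Lemma polyfun_map_differentiable (R : realType) (n : nat)
    (F : 'rV[R]_n -> 'rV[R]_n) (x : 'rV[R]_n) :
  (forall i, polyfun (fun x => F x 0 i)) -> differentiable F x.
Proof.
move=> pF; apply: differentiable_mx => i j; rewrite ord1.
exact: polyfun_differentiable.
Qed.

Lemma JFE (R : realType) (n : nat) (F : 'rV[R]_n -> 'rV[R]_n) (x : 'rV[R]_n)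
    (i j : 'I_n) :
  differentiable F x ->
  JF F x i j = 'D_(delta_mx 0 j) (fun y => F y 0 i) x.
Proof.
move=> dF; rewrite /JF mxE.
have := deriveEjacobian (delta_mx 0 j) dF.
rewrite derive_mx; last exact: diff_derivable.
by move=> /matrixP/(_ 0 i); rewrite -rowE !mxE.
Qed.

Lemma polyfun_C1 (R : realType) (n : nat) (F : 'rV[R]_n -> 'rV[R]_n) :
  (forall i, polyfun (fun x => F x 0 i)) -> C1_map F.
Proof.
move=> pF; have dF x := polyfun_map_differentiable x pF.
split=> // x; apply: differentiable_continuous; apply: differentiable_mx => i j.
apply: polyfun_differentiable.
by apply: polyfun_eq (polyfun_derive (delta_mx 0 j) (pF i)) _ => y; rewrite JFE.
Qed.

Lemma is_derive_ext (R : realType) (V : normedModType R) (f h : V -> R)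
    (x v : V) (df dh : R) : is_derive x v f df -> f =1 h -> df = dh ->
  is_derive x v h dh.
Proof. by move=> D /funext <- <-. Qed.

(** * The components of H and of F *)

(** Merges the cases i < n and i = n, since [coord1 x n.+1] is 0, and absorbs the factorials into
    the Taylor coefficients of a. *)
Lemma HcompE (R : realType) (n : nat) (a g : {poly R}) (x : 'rV[R]_n)
    (i : nat) :
  (0 < i <= n)%N ->
  let ga := g.[coord1 x 2%N - a.[coord1 x 1%N]] in
  Hcomp a g x i = if i == 1%N then ga else
    coord1 x i.+1 + taylor_term (fun k => a^`N(k).[coord1 x 1%N]) ga i.
Proof.
move=> /andP[i0 lin] /=; rewrite /Hcomp; case: ifP => // _.
have f0 k : (k`!)%:R != 0 :> R by rewrite pnatr_eq0 -lt0n fact_gt0.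
have qE k (z : R) : (-1) ^+ k / (k.-1)`!%:R * a^`(k.-1).[coord1 x 1%N] * z =
   (-1) ^+ k * a^`N(k.-1).[coord1 x 1%N] * z.
  rewrite nderivn_def hornerMn -[_.[_] *+ _]mulr_natr; congr (_ * _).
  by move: (_%:R) (f0 k.-1) => c c0; field.
rewrite !qE /taylor_term; case: ltnP => // nlei.
have -> : i = n by apply/eqP; rewrite eqn_leq lin.
by rewrite (_ : coord1 x n.+1 = 0) ?add0r //; exact: rV_coord_out.
Qed.

Lemma is_derive_Hcomp (R : realType) (n : nat) (a g : {poly R}) (x v : 'rV[R]_n)
    (i : nat) :
  (0 < i <= n)%N ->
  let u := coord1 x 2%N - a.[coord1 x 1%N] in
  is_derive x v (fun y => Hcomp a g y i)
    (diffH (fun k => a^`N(k).[coord1 x 1%N]) g.[u] g^`().[u] (coord1 v) i).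
Proof.
move=> lin /=; rewrite (funext (fun y => HcompE a g y lin)) /=.
rewrite /diffH.
have dc k := is_derive_coord1 x v k.
have du : is_derive x v (fun y : 'rV[R]_n => coord1 y 2%N - a.[coord1 y 1%N])
   (coord1 v 2%N - a^`N(1).[coord1 x 1%N] * coord1 v 1%N).
  by rewrite nderivn1;
    exact: is_deriveB (dc 2%N) (is_derive_horner_comp a (dc 1%N)).
have dg := is_derive_horner_comp g du.
case: ifP => i1; first exact: dg.
rewrite /taylor_term.
have da := is_derive_horner_comp (a^`N(i.-1)) (dc 1%N).
apply: is_derive_ext
  (is_deriveD (dc i.+1)
  (is_deriveZ ((-1) ^+ i) (is_deriveM da (is_deriveX i.-1 dg)))) _ _.
  by move=> y; rewrite !fctE -mulrA.
(* Differentiating the coefficient of index i-1 produces the factor [i%:R * al i] of [diffH]. *)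
rewrite deriv_nderivn prednK ?hornerMn; last by case/andP: lin.
rewrite -[_.[_] *+ _]mulr_natl /GRing.scale /= !fctE.
ring.
Qed.

Lemma coord1_ord (R : realType) (n : nat) (x : 'rV[R]_n) (j : 'I_n) :
  coord1 x j.+1 = x 0 j.
Proof. exact: rV_coord_ord. Qed.

Lemma coord1P (R : realType) (n : nat) (x y : 'rV[R]_n) :
  (forall i, (0 < i <= n)%N -> coord1 x i = coord1 y i) -> x = y.
Proof.
move=> E; apply/rowP => j; have := E j.+1 (ltn_ord j).
by rewrite !coord1_ord.
Qed.

Lemma coord1_row (R : realType) (n : nat) (f : nat -> R) (i : nat) :
  (0 < i <= n)%N -> coord1 (\row_(j < n) f j.+1) i = f i.
Proof. by case/ord_of_coord => j ->; rewrite coord1_ord mxE. Qed.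

Lemma coord1_F (R : realType) (n : nat) (lambda : R) (a g : {poly R})
    (x : 'rV[R]_n) (i : nat) :
  (0 < i <= n)%N ->
  coord1 (lambda *: x + Hmap a g x) i = lambda * coord1 x i + Hcomp a g x i.
Proof. by case/ord_of_coord => j ->; rewrite !coord1_ord !mxE. Qed.

Lemma polyfun_taylor_term (R : realType) (n : nat) (a : {poly R})
    (f h : 'rV[R]_n -> R) (i : nat) :
  polyfun f -> polyfun h ->
  polyfun (fun x => taylor_term (fun k => a^`N(k).[f x]) (h x) i).
Proof.
move=> pf ph; apply: polyfunM; last exact: polyfunX.
by apply: polyfunM; [exact: polyfun_cst|exact: polyfun_horner].
Qed.

Lemma polyfun_F (R : realType) (n : nat) (lambda : R) (a g : {poly R})
    (i : 'I_n) :
  polyfun (fun x : 'rV[R]_n => (lambda *: x + Hmap a g x) 0 i).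
Proof.
have c k := polyfun_coord1 R n k.
have pg : polyfun (fun x : 'rV[R]_n => g.[coord1 x 2 - a.[coord1 x 1]]).
  apply: polyfun_horner; apply: (polyfunD (c 2%N)).
  by apply: polyfunN; apply: polyfun_horner.
apply: (@polyfun_eq _ _ (fun x : 'rV[R]_n => lambda * coord1 x i.+1 +
    (if i.+1 == 1%N then g.[coord1 x 2 - a.[coord1 x 1]] else
    coord1 x i.+2 + taylor_term (fun k => a^`N(k).[coord1 x 1])
      g.[coord1 x 2 - a.[coord1 x 1]] i.+1))); last first.
  move=> x; rewrite -(HcompE a g x (i := i.+1) (ltn_ord i)).
  by rewrite -coord1_F ?ltn_ord // coord1_ord.
apply polyfunD; first exact: polyfunM (polyfun_cst n lambda) (c i.+1).
by case: (i.+1 == 1%N) => //; apply polyfunD => //; exact: polyfun_taylor_term.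
Qed.

(** * The polynomial inverse *)

(** Recovers u = x_2 - a(x_1) from y = F(x). *)
Definition u_inv (R : realType) (n : nat) (lambda : R) (a : {poly R})
    (y : 'rV[R]_n) : R :=
  \sum_(2 <= k < n.+1) back_coef lambda (k - 2) * coord1 y k -
  a.[coord1 y 1 / lambda].

(** Once u is known, the first equation gives x_1, and the others form a triangular linear system
    for x_2, ..., x_n. *)
Definition F_inv_comp (R : realType) (n : nat) (lambda : R) (a g : {poly R})
    (y : 'rV[R]_n) (i : nat) : R :=
  let ga := g.[u_inv lambda a y] in
  let x1 := (coord1 y 1 - ga) / lambda in
  if i == 1%N then x1 else \sum_(i <= k < n.+1)
    back_coef lambda (k - i) *
      (coord1 y k - taylor_term (fun k => a^`N(k).[x1]) ga k).

Definition F_inv (R : realType) (n : nat) (lambda : R) (a g : {poly R})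
    (y : 'rV[R]_n) : 'rV[R]_n :=
  \row_(j < n) F_inv_comp lambda a g y j.+1.

Lemma polyfun_F_inv (R : realType) (n : nat) (lambda : R) (a g : {poly R})
    (i : 'I_n) :
  polyfun (fun y : 'rV[R]_n => F_inv lambda a g y 0 i).
Proof.
have c k := polyfun_coord1 R n k.
have s (j : nat) (w : nat -> R) (f : nat -> 'rV[R]_n -> R) :
  (forall k, polyfun (f k)) ->
    polyfun (fun y => \sum_(j <= k < n.+1) w k * f k y).
  move=> pf; apply: (@polyfun_sum _ _ _ (fun k y => w k * f k y)) => k.
  exact: polyfunM (polyfun_cst n (w k)) (pf k).
have pd (f : 'rV[R]_n -> R) : polyfun f -> polyfun (fun y => f y / lambda).
  by move=> pf; exact: polyfunM pf (polyfun_cst n lambda^-1).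
have pg : polyfun (fun y : 'rV[R]_n => g.[u_inv lambda a y]).
  apply: polyfun_horner; apply polyfunD; first exact: s.
  by apply: polyfunN; apply: polyfun_horner; exact: pd.
have px :
  polyfun (fun y : 'rV[R]_n => (coord1 y 1 - g.[u_inv lambda a y]) / lambda).
  by apply: pd; apply polyfunD => //; exact: polyfunN.
apply: (@polyfun_eq _ _ (fun y => F_inv_comp lambda a g y i.+1)); last first.
  by move=> y; rewrite mxE.
rewrite /F_inv_comp; case: (i.+1 == 1%N) => //.
by apply: s => k; apply polyfunD => //; apply: polyfunN;
  exact: polyfun_taylor_term.
Qed.

Lemma coord1_out (R : realType) (n : nat) (x : 'rV[R]_n) : coord1 x n.+1 = 0.
Proof. exact: rV_coord_out. Qed.

Lemma u_inv_F (R : realType) (n : nat) (lambda : R) (a g : {poly R})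
    (x : 'rV[R]_n) :
  (1 < n)%N -> lambda != 0 -> (size a <= n)%N ->
  u_inv lambda a (lambda *: x + Hmap a g x) = coord1 x 2 - a.[coord1 x 1].
Proof.
move=> n1 l0 san; rewrite /u_inv coord1_F ?(ltnW n1) // HcompE ?(ltnW n1) //=.
set ga := g.[_].
rewrite big_nat
  (eq_bigr
  (fun k => back_coef lambda (k - 2) * (lambda * coord1 x k + coord1 x k.+1)
  + back_coef lambda (k - 2) * taylor_term (fun k => a^`N(k).[coord1 x 1]) ga
    k)); last first.
  move=> k /andP[k1 kn]; rewrite coord1_F ?HcompE ?(ltnW k1) //.
  by rewrite ifN_eqC ?neq_ltn ?k1 // -mulrDr addrA.
rewrite -big_nat big_split /= sum_taylor_term ?(ltnW n1) //.
rewrite (back_substitution l0 (leqW n1) (coord1_out x)).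
(* Here y_1/lambda = x_1 + ga/lambda, so the two values of a at that point cancel. *)
by rewrite [in X in _ - X]mulrDl mulrAC divff // mul1r; ring.
Qed.

Lemma F_invK (R : realType) (n : nat) (lambda : R) (a g : {poly R}) :
  (1 < n)%N -> lambda != 0 -> (size a <= n)%N ->
  cancel (fun x : 'rV[R]_n => lambda *: x + Hmap a g x) (F_inv lambda a g).
Proof.
move=> n1 l0 san x; apply: coord1P => i /[dup] /andP[i0 lin] li.
rewrite coord1_row // /F_inv_comp u_inv_F // coord1_F ?(ltnW n1) //
  HcompE ?(ltnW n1) //=.
rewrite addrK mulrAC divff // mul1r; case: eqVneq => [->//|i1].
rewrite -[RHS](back_substitution l0 _ (coord1_out x)) ?leqW //.
rewrite big_nat [RHS]big_nat; apply: eq_bigr => k /andP[lik lkn].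
rewrite coord1_F ?HcompE ?lkn ?(leq_trans i0) // ifN; first by congr (_ * _);
  ring.
by lia.
Qed.

(** The point is consistency ([Eu]): the constructed x satisfies x_2 - a(x_1) = [u_inv lambda a y],
    so H at x uses the same [ga] as its construction. *)
Lemma F_invKr (R : realType) (n : nat) (lambda : R) (a g : {poly R}) :
  (1 < n)%N -> lambda != 0 -> (size a <= n)%N ->
  cancel (F_inv lambda a g) (fun x : 'rV[R]_n => lambda *: x + Hmap a g x).
Proof.
move=> n1 l0 san y; apply: coord1P => i /[dup] /andP[i0 lin] li.
rewrite coord1_F // HcompE //.
have E k : (0 < k <= n)%N ->
  coord1 (F_inv lambda a g y) k = F_inv_comp lambda a g y k.
  exact: coord1_row.
set ga := g.[u_inv lambda a y]; set x1 := (coord1 y 1 - ga) / lambda.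
have E1 : coord1 (F_inv lambda a g y) 1 = x1 by rewrite E ?(ltnW n1).
(* For k = n+1 the empty sum agrees with the default coordinate 0, which covers i = n below. *)
have Ei k : (1 < k <= n.+1)%N -> coord1 (F_inv lambda a g y) k =
    \sum_(k <= m < n.+1) back_coef lambda (m - k) *
      (coord1 y m - taylor_term (fun m => a^`N(m).[x1]) ga m).
  move=> /andP[k1]; rewrite leq_eqVlt => /predU1P[->|kn].
    by rewrite coord1_out big_geq.
  by rewrite E ?(ltnW k1) // /F_inv_comp ifN //; lia.
have Eu : coord1 (F_inv lambda a g y) 2 - a.[x1] = u_inv lambda a y.
  rewrite Ei ?(leqW n1) // /u_inv.
  under eq_bigr do rewrite mulrBr.
  rewrite sumrB sum_taylor_term ?(ltnW n1) //.
  have -> : x1 + ga / lambda = coord1 y 1 / lambda by rewrite /x1; ring.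
  by ring.
rewrite E1 Eu -/ga; case: eqVneq => [->|i1].
  by rewrite E1 /x1; field.
have i2 : (1 < i)%N by lia.
rewrite !Ei ?i2 ?ltnS ?lin ?(leqW lin) ?(ltnW i2) //.
by rewrite addrA back_substitution_step // subrK.
Qed.

(** * Eigenvalues and determinant of JF *)

(** The characteristic polynomials agree. Since [eigenvalue] refers to row vectors, this gives
    access to column eigenvectors of JF. *)
Lemma eigenvalue_trmx (K : fieldType) (n : nat) (A : 'M[K]_n) (z : K) :
  eigenvalue A^T z = eigenvalue A z.
Proof.
rewrite !eigenvalue_root_char; congr (root _ z).
rewrite /char_poly -[RHS]det_tr; congr (\det _).
by apply/matrixP => i j; rewrite !mxE eq_sym.
Qed.

(** The characteristic polynomial splits as (X - c)^n, and its value at 0 is (-1)^n times the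
    determinant. *)
Lemma det_single_eigenvalue (K : closedFieldType) (n : nat) (A : 'M[K]_n)
    (c : K) :
  (forall z, eigenvalue A z -> z = c) -> \det A = c ^+ n.
Proof.
move=> eA; have [r rE] := closed_field_poly_normal (char_poly A).
rewrite (monicP (char_poly_monic A)) scale1r in rE.
have rc : all (pred1 c) r.
  by apply/allP => z zr; apply/eqP/eA;
    rewrite eigenvalue_root_char rE root_prod_XsubC.
have sr : size r = n.
  by have := size_char_poly A; rewrite rE size_prod_XsubC => -[].
apply: (@mulfI _ ((-1) ^+ n)); first by rewrite signr_eq0.
rewrite -char_poly_det rE -horner_coef0 horner_prod (all_pred1P _ _ rc) sr.
rewrite big_nseq iter_mulr_1 !hornerE; exact: exprNn.
Qed.

Lemma eigenvalue_JF (R : realType) (n : nat) (lambda : R) (a g : {poly R})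
    (x : 'rV[R]_n) (K : fieldType) (phi : {rmorphism R -> K}) (z : K) :
  (1 < n)%N -> (size a <= n)%N ->
  eigenvalue (map_mx phi (JF (fun x => lambda *: x + Hmap a g x) x)) z ->
  z = phi lambda.
Proof.
move=> n1 san; rewrite -eigenvalue_trmx => /eigenvalueP[v vJ v0].
(* Otherwise mu = [phi lambda - z] is nonzero, and the elimination forces the eigenvector to
   vanish. *)
apply/eqP; rewrite -[_ == _]negbK eq_sym -subr_eq0; apply/negP => mu0.
set F := fun x => _ in vJ.
have dF : differentiable F x by apply: polyfun_map_differentiable;
  exact: polyfun_F.
pose al k := a^`N(k).[coord1 x 1]; pose u := coord1 x 2 - a.[coord1 x 1].
have JE (i j : 'I_n) : JF F x i j =
   lambda * rV_coord (delta_mx 0 j) i.+1 + diffH al g.[u] g^`().[u]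
     (rV_coord (delta_mx 0 j)) i.+1.
  rewrite JFE //.
  have dH := is_derive_Hcomp a g x (delta_mx 0 j) (i := i.+1) (ltn_ord i).
  have dc := is_derive_coord1 x (delta_mx 0 j) i.+1.
  have := is_deriveD (is_deriveZ lambda dc) dH.
  rewrite (_ : _ + _ = fun y => F y 0 i); first by case.
  by apply/funext => y; rewrite -coord1_ord coord1_F ?ltn_ord.
case/negP: v0; apply/eqP/rowP => j; rewrite mxE -rV_coord_ord.
apply: (@addr_diffH_injective _ n (phi \o al) (phi g.[u]) (phi g^`().[u]) _
  (rV_coord v)); last exact: ltn_ord.
- exact: n1.
- exact: mu0.
- rewrite /= /al.
  (* This is where deg a < n enters. *)
  have -> : a^`N(n) = 0 by exact: nderivn_poly0.
  by rewrite horner0 rmorph0.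
- exact: rV_coord_out.
move=> _ /ord_of_coord[i ->]; rewrite mulrBl.
have := congr1 (fun w : 'rV_n => w 0 i) vJ;
  rewrite [in LHS]mxE [RHS]mxE -rV_coord_ord => <-.
under eq_bigr do rewrite 2![in X in _ * X]mxE JE rmorphD rmorphM mulrDr mulrCA.
rewrite big_split /= sum_diffH -mulr_sumr sum_rV_coord_delta; ring.
Qed.

Theorem proposition3 (R : realType) (n : nat) (lambda : R) (a g : {poly R})
    (hn : (4 <= n)%N) (hlambda : lambda != 0)
    (* [size] is the degree plus one, so this is deg a = n - 1 *)
    (ha : size a = n)
    (hg0 : g.[0] = 0) (hg : (1 <= (size g).-1)%N) :
  let F := fun x : 'rV[R]_n => lambda *: x + Hmap a g x in
  [/\ polynomial_map F,
      bijective_with_polynomial_inverse F,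
      lambda = 1 -> example_to_Jacobian_conjecture F
    & lambda < 0 -> example_to_weak_Markus_Yamabe_conjecture F].
Proof.
move=> F; have n1 : (1 < n)%N by exact: leq_trans hn.
have san : (size a <= n)%N by rewrite ha.
have pF : polynomial_map F by apply: polyfun_map; exact: polyfun_F.
have bF : bijective_with_polynomial_inverse F.
  exists (F_inv lambda a g); split; [|exact: F_invK|exact: F_invKr].
  by apply: polyfun_map; exact: polyfun_F_inv.
have eF x := @eigenvalue_JF R n lambda a g x R[i] (real_complex R) _ n1 san.
split=> // [l1|l0]; split=> //.
(* The determinant is computed over R[i], where the characteristic polynomial splits, and descends
   to R by injectivity. *)
- move=> x; apply: (fmorph_inj (real_complex R)).
  rewrite -det_map_mx (det_single_eigenvalue (fun z => eF z x)) l1 !rmorph1;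
    exact: expr1n.
- by apply: polyfun_C1; exact: polyfun_F.
- by move=> x z /eF ->.
- exact: can_inj (F_invK g n1 hlambda san).
Qed.
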